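(* Let $G=(V,E)$ be a finite, simple, connected graph with at least two vertices, let $m$ be a weight function on $G$, and let $w$ be another weight function on $G$. To each ordered pair $(x,y)\in V\times V$ of distinct vertices assign one path $\gamma(x,y)\in\Gamma(x,y)$. Define $$A(w)=\max_{e\in\vec{E}}\left\{\frac{1}{m(\emptyset)}\,\frac{1}{m(e)}\,w(e)\sum_{(x,y)\ \text{s.t.}\ \gamma(x,y)\ni e}|\gamma(x,y)|_w\, m(x)m(y)\right\},$$ where the sum is over all ordered pairs $(x,y)$ of distinct vertices such that the oriented edge $e$ occurs in the path $\gamma(x,y)$. Then for every metric space $X$ with at least two points, $$\lambda(G,X)\ge\frac{1}{A(w)},$$ where $\lambda(G,X)$ is the nonlinear spectral gap of the weighted graph $(G,m)$ with respect to $X$.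
   Context: For a graph $G=(V,E)$, let $\vec{E}=\{(x,y)\in V\times V : \{x,y\}\in E\}$. A weight function on $G$ is a symmetric function $m:V\times V\to[0,\infty)$ whose support equals $\vec{E}$; for $e=(x,y)\in\vec E$ write $m(e)=m(x,y)$. Write $m(x)=\sum_{y\in V}m(x,y)$ and $m(\emptyset)=\sum_{x\in V}m(x)$. A path on $G$ is a finite sequence $(x_1,x_2),(x_2,x_3),\ldots,(x_n,x_{n+1})$ in $\vec{E}$ such that all the vertices $x_1,\ldots,x_{n+1}$ are distinct. For distinct $x,y\in V$, $\Gamma(x,y)$ denotes the set of all paths from $x$ to $y$. For a weight function $w$ and a path $\gamma:(x_1,x_2),\ldots,(x_n,x_{n+1})$ put $|\gamma|_w=\sum_{i=1}^{n}\frac{1}{w(x_i,x_{i+1})}$. For a metric space $(X,d_X)$ with at least two points, the nonlinear spectral gap $\lambda(G,X)$ of the weighted graph $(G,m)$ is the reciprocal of the smallest constant $C>0$ such that for every map $f:V\to X$ $$\frac{1}{m(\emptyset)}\sum_{x,y\in V}m(x)m(y)\,d_X(f(x),f(y))^2\le C\sum_{x,y\in V}m(x,y)\,d_X(f(x),f(y))^2 .$$ *)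

(* Defs.v *)
From HB Require Import structures.
From mathcomp Require Import all_boot all_order all_algebra.
From mathcomp Require Import all_classical all_reals all_analysis.

Set Implicit Arguments.
Unset Strict Implicit.
Unset Printing Implicit Defensive.
Import Order.TTheory GRing.Theory Num.Theory.

Local Open Scope classical_set_scope.
Local Open Scope ring_scope.

(* A simple graph on V is a symmetric irreflexive adjacency relation E : rel V;
   the oriented edges are the pairs (x, y) with E x y. *)
Definition simple_graph (V : finType) (E : rel V) : Prop :=
  symmetric E /\ irreflexive E.

Definition connected_graph (V : finType) (E : rel V) : Prop :=
  forall x y : V, connect E x y.

Definition weight_function (R : realType) (V : finType) (E : rel V)
    (m : V -> V -> R) : Prop :=
  [/\ forall x y, m x y = m y x,
      forall x y, 0 <= m x y
    & forall x y, (m x y != 0) = E x y].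

Definition vweight (R : realType) (V : finType) (m : V -> V -> R) (x : V) : R :=
  \sum_(y : V) m x y.

Definition tweight (R : realType) (V : finType) (m : V -> V -> R) : R :=
  \sum_(x : V) vweight m x.

(* A path (x, p_0), (p_0, p_1), ..., (p_(n-1), p_n) is encoded by its initial
   vertex x and the sequence p of its remaining vertices. *)
Definition path_between (V : finType) (E : rel V) (x y : V) (p : seq V) : bool :=
  [&& path E x p, last x p == y & uniq (x :: p)].

Definition path_edges (V : finType) (x : V) (p : seq V) : seq (V * V) :=
  pairmap (fun a b => (a, b)) x p.

Definition path_length (R : realType) (V : finType) (w : V -> V -> R)
    (x : V) (p : seq V) : R :=
  \sum_(e <- path_edges x p) 1 / w e.1 e.2.

(* The terms are nonnegative, so the unit 0 of the iterated maximum does not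
   affect its value as soon as the graph has an edge. *)
Definition path_constant (R : realType) (V : finType) (E : rel V)
    (m w : V -> V -> R) (gamma : V -> V -> seq V) : R :=
  \big[Num.max/0]_(e : V * V | E e.1 e.2)
    (1 / tweight m * (1 / m e.1 e.2) * w e.1 e.2 *
     \sum_(xy : V * V | (xy.1 != xy.2)
                        && (e \in path_edges xy.1 (gamma xy.1 xy.2)))
       path_length w xy.1 (gamma xy.1 xy.2)
       * vweight m xy.1 * vweight m xy.2).

Definition poincare_constant (R : realType) (V : finType) (m : V -> V -> R)
    (X : metricType R) : set R :=
  [set C : R | 0 < C /\
    forall f : V -> X,
      1 / tweight m *
        (\sum_(x : V) \sum_(y : V)
           vweight m x * vweight m y * mdist (f x) (f y) ^+ 2)
      <= C * \sum_(x : V) \sum_(y : V) m x y * mdist (f x) (f y) ^+ 2].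

Definition least_elements (R : realType) (S : set R) : set R :=
  [set c | S c /\ forall c', S c' -> c <= c'].

(* The reciprocal of the smallest Poincare constant; it would be 0 if there
   were no smallest constant. *)
Definition spectral_gap (R : realType) (V : finType) (m : V -> V -> R)
    (X : metricType R) : R :=
  (xget 0 (least_elements (poincare_constant m X)))^-1.

(* Main.v *)
Require Import Defs.
From HB Require Import structures.
From mathcomp Require Import all_boot all_order all_algebra.
From mathcomp Require Import all_classical all_reals all_analysis.
From mathcomp Require Import ring lra.
Import Order.TTheory GRing.Theory Num.Theory.
Local Open Scope ring_scope.
Set Implicit Arguments.
Unset Strict Implicit.
Unset Printing Implicit Defensive.

(* Along the chosen path from x to y, the triangle inequality and the
   Cauchy-Schwarz inequality with weights w give
     d(f x, f y)^2 <= |gamma(x,y)|_w * \sum_(e in gamma(x,y)) w(e) d(f e)^2.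
   Multiplying by m(x) m(y), summing over (x, y) and exchanging the two sums,
   A(w) satisfies the Poincare inequality for every f.  A map separating one
   vertex from the others has positive energy, so the Poincare constants are
   bounded away from 0; their infimum is then the smallest one, and it is
   positive and at most A(w). *)

(** Induction on [s]: expanding the product for [a :: s] leaves two cross terms, which must absorb
    [2 * (d a * D)]. *)
Lemma weighted_cauchy_schwarz (R : realFieldType) (I : eqType) (s : seq I)
    (w d : I -> R) :
  {in s, forall i, 0 < w i} ->
  (\sum_(i <- s) d i) ^+ 2
    <= (\sum_(i <- s) 1 / w i) * \sum_(i <- s) w i * d i ^+ 2.
Proof.
elim: s => [|a s IH] ws; first by rewrite !big_nil expr0n mul0r.
rewrite !big_cons.
have {IH} := IH (fun i si => ws i (mem_behead (s := a :: s) si)).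
have wa : 0 < w a by apply: ws; rewrite mem_head.
have : 0 <= \sum_(i <- s) 1 / w i.
  rewrite big_seq; apply: sumr_ge0 => i si.
  by rewrite divr_ge0 // ltW // ws // inE si orbT.
have : 0 <= \sum_(i <- s) w i * d i ^+ 2.
  rewrite big_seq; apply: sumr_ge0 => i si.
  by rewrite mulr_ge0 ?sqr_ge0 // ltW // ws // inE si orbT.
move: (\sum_(i <- s) d i) (\sum_(i <- s) 1 / w i)
  (\sum_(i <- s) w i * d i ^+ 2) => D L Q Q0 L0 DLQ.
have LwQ : 2 * (d a * D) <= L * (w a * d a ^+ 2) + Q / w a.
  have P0 : 0 <= L * (w a * d a ^+ 2).
    by rewrite mulr_ge0 // mulr_ge0 ?sqr_ge0 // ltW.
  have N0 : 0 <= Q / w a by rewrite divr_ge0 // ltW.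
  (* The sign of [d a * D] is unknown, so its absolute value is squared. For the cross terms P and
     N, P N = d_a^2 L Q >= (d_a D)^2, and 4 P N <= (P + N)^2. *)
  rewrite (le_trans (ler_norm _)) // -ler_sqr ?nnegrE ?addr_ge0 //.
  rewrite real_normK ?num_real //.
  have PN : L * (w a * d a ^+ 2) * (Q / w a) = d a ^+ 2 * (L * Q).
    by field; rewrite gt_eqF.
  have := ler_wpM2l (sqr_ge0 (d a)) DLQ; rewrite -PN.
  move: (L * _) (Q / _) => P N.
  have := sqr_ge0 (P - N); nra.
have -> : (1 / w a + L) * (w a * d a ^+ 2 + Q)
          = d a ^+ 2 + (L * (w a * d a ^+ 2) + Q / w a) + L * Q.
  by field; rewrite gt_eqF.
by nra.
Qed.

Lemma map_snd_path_edges (V : finType) (x : V) (p : seq V) :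
  map snd (path_edges x p) = p.
Proof. by elim: p x => //= y p IH x; congr cons; apply: IH. Qed.

(** The edges of a path have distinct targets, so no oriented edge is repeated. *)
Lemma uniq_path_edges (V : finType) (x : V) (p : seq V) :
  uniq p -> uniq (path_edges x p).
Proof. by rewrite -{1}(map_snd_path_edges x p) => /map_uniq. Qed.

Lemma path_edges_sub (V : finType) (E : rel V) (x : V) (p : seq V) :
  path E x p -> {in path_edges x p, forall e, E e.1 e.2}.
Proof.
elim: p x => //= y p IH x /andP[Exy /IH Ep] e.
by rewrite inE => /predU1P[-> //|/Ep].
Qed.

Lemma mdist_path_edges (R : realType) (V : finType) (X : metricType R)
    (f : V -> X) (x : V) (p : seq V) :
  mdist (f x) (f (last x p))
    <= \sum_(e <- path_edges x p) mdist (f e.1) (f e.2).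
Proof.
elim: p x => [|y p IH] x /=; first by rewrite mdistxx big_nil.
rewrite big_cons /= (le_trans (metric_triangle _ (f y) _)) // lerD2l.
exact: IH.
Qed.

Section PoincareInequality.
Context (R : realType) (V : finType) (E : rel V) (m w : V -> V -> R).
Hypotheses (hm : weight_function E m) (hw : weight_function E w).

Lemma weight_gt0 (u : V -> V -> R) (x y : V) :
  weight_function E u -> E x y -> 0 < u x y.
Proof. by case=> _ u0 uE Exy; rewrite lt_def uE Exy u0. Qed.

Lemma vweight_ge0 (x : V) : 0 <= vweight m x.
Proof. by case: hm => _ m0 _; apply: sumr_ge0. Qed.

(** The first edge of a path from [x] to some other vertex contributes a positive term. *)
Lemma vweight_gt0 (x : V) :
  connected_graph E -> (1 < #|V|)%N -> 0 < vweight m x.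
Proof.
move=> hconn hV; case: (hm) => _ m0 mE.
have [y yx] : exists y, y != x.
  move: hV; rewrite (cardD1 x) => /card_gt0P[y].
  by rewrite inE => /andP[yx _]; exists y.
case/connectP: (hconn x y) => -[|z p] /= ep ey.
  by rewrite ey eqxx in yx.
case/andP: ep => Exz _; rewrite /vweight (bigD1 z) //=.
by rewrite ltr_pwDl ?(weight_gt0 hm) // sumr_ge0.
Qed.

Lemma tweight_ge0 : 0 <= tweight m.
Proof. by apply: sumr_ge0 => x _; apply: vweight_ge0. Qed.

Lemma path_length_ge0 (x : V) (p : seq V) :
  path E x p -> 0 <= path_length w x p.
Proof.
move=> /path_edges_sub Ep; rewrite /path_length big_seq.
by apply: sumr_ge0 => e /Ep Ee; rewrite divr_ge0 // ltW // (weight_gt0 hw).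
Qed.

Context (gamma : V -> V -> seq V) (X : metricType R).
Hypothesis hgamma : forall x y : V, x != y -> path_between E x y (gamma x y).

(** The edge sum is indexed by membership, not by the list, so that it can later be exchanged with
    the sum over pairs of vertices. *)
Lemma sqr_mdist_path (f : V -> X) (x y : V) : x != y ->
  mdist (f x) (f y) ^+ 2
    <= path_length w x (gamma x y)
       * \sum_(e in path_edges x (gamma x y)) w e.1 e.2
                                      * mdist (f e.1) (f e.2) ^+ 2.
Proof.
move=> /hgamma /and3P[Ep /eqP lastp] /= /andP[_ up].
rewrite -big_uniq ?uniq_path_edges //=.
apply: le_trans (weighted_cauchy_schwarz _ _); last first.
  by move=> e /(path_edges_sub Ep) Ee; apply: (weight_gt0 hw).
rewrite ler_sqr ?nnegrE ?mdist_ge0 ?sumr_ge0 //; last first.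
  by move=> e _; apply: mdist_ge0.
by rewrite -{1}lastp mdist_path_edges.
Qed.

Lemma path_constant_poincare (f : V -> X) :
  1 / tweight m *
    (\sum_(x : V) \sum_(y : V)
       vweight m x * vweight m y * mdist (f x) (f y) ^+ 2)
  <= path_constant E m w gamma
     * \sum_(x : V) \sum_(y : V) m x y * mdist (f x) (f y) ^+ 2.
Proof.
have T0 : 0 <= 1 / tweight m by rewrite divr_ge0 // tweight_ge0.
pose g (e : V * V) := mdist (f e.1) (f e.2) ^+ 2.
pose L (xy : V * V) := path_length w xy.1 (gamma xy.1 xy.2)
                       * vweight m xy.1 * vweight m xy.2.
pose inpath (xy e : V * V) := e \in path_edges xy.1 (gamma xy.1 xy.2).
have Einpath (xy e : V * V) : xy.1 != xy.2 -> inpath xy e -> E e.1 e.2.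
  by move=> /hgamma /and3P[/path_edges_sub Ep _ _] /Ep.
rewrite !pair_bigA /=.
have -> : \sum_(p : V * V) m p.1 p.2 * mdist (f p.1) (f p.2) ^+ 2
          = \sum_(p : V * V | E p.1 p.2) m p.1 p.2 * g p.
  rewrite [RHS]big_mkcond; apply: eq_bigr => e _.
  case: hm => _ _ mE; rewrite -mE.
  by case: eqP => [->|//]; rewrite mul0r.
have sumle : \sum_(p : V * V) vweight m p.1 * vweight m p.2
                              * mdist (f p.1) (f p.2) ^+ 2
    <= \sum_(e : V * V | E e.1 e.2) w e.1 e.2 * g e
         * \sum_(xy : V * V | (xy.1 != xy.2) && inpath xy e) L xy.
  under [leRHS]eq_bigr do rewrite mulr_sumr.
  (* By [Einpath], restricting the outer sum to edges of the graph loses no edge of a chosen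
     path. *)
  rewrite -(exchange_big_dep _ (P := fun xy => xy.1 != xy.2) (Q := inpath)
              (F := fun xy e => w e.1 e.2 * g e * L xy)) //=.
  rewrite [leRHS]big_mkcond; apply: ler_sum => -[x y] _ /=.
  (* Diagonal pairs carry no path, but their distance is zero. *)
  case: eqVneq => [->|xy]; first by rewrite mdistxx expr0n mulr0.
  rewrite -mulr_suml /L /= mulrC !mulrA ler_wpM2r ?vweight_ge0 //.
  rewrite ler_wpM2r ?vweight_ge0 // mulrC.
  exact: sqr_mdist_path.
apply: le_trans (ler_wpM2l T0 sumle) _; rewrite !mulr_sumr.
apply: ler_sum => e Ee; have me := weight_gt0 hm Ee.
set S := \sum_(xy : V * V | _) L xy.
have -> : 1 / tweight m * (w e.1 e.2 * g e * S)
          = 1 / tweight m * (1 / m e.1 e.2) * w e.1 e.2 * S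
            * (m e.1 e.2 * g e).
  (* Inserting m(e)/m(e) = 1 produces the quantity maximised in [path_constant]. *)
  transitivity (1 / tweight m * (w e.1 e.2 * g e * S)
                * (m e.1 e.2 / m e.1 e.2)); last by ring.
  by rewrite divff ?mulr1 // gt_eqF.
apply: ler_wpM2r; first by rewrite mulr_ge0 ?sqr_ge0 // ltW.
by rewrite /path_constant (bigD1 e) //= le_max lexx.
Qed.

End PoincareInequality.

Unset Implicit Arguments.
Set Strict Implicit.

Theorem theorem1p3 (R : realType) (V : finType) (E : rel V)
    (hE : simple_graph E) (hconn : connected_graph E) (hV : (1 < #|V|)%N)
    (m w : V -> V -> R)
    (hm : weight_function E m) (hw : weight_function E w)
    (gamma : V -> V -> seq V)
    (hgamma : forall x y : V, x != y -> path_between E x y (gamma x y))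
    (X : metricType R) (hX : exists a b : X, a <> b) :
  spectral_gap m X >= 1 / path_constant E m w gamma.
Proof.
pose A := path_constant E m w gamma.
pose lhs (f : V -> X) := 1 / tweight m *
  (\sum_(x : V) \sum_(y : V)
     vweight m x * vweight m y * mdist (f x) (f y) ^+ 2).
pose energy (f : V -> X) :=
  \sum_(x : V) \sum_(y : V) m x y * mdist (f x) (f y) ^+ 2.
have poincareA f : lhs f <= A * energy f
  by apply: path_constant_poincare.
have m0 x y : 0 <= m x y by case: hm.
have v0 x : 0 < vweight m x by apply: (vweight_gt0 hm).
have energy0 f : 0 <= energy f.
  by apply: sumr_ge0 => x _; apply: sumr_ge0 => y _; rewrite mulr_ge0 ?sqr_ge0.
have [f0 lhs_f0] : exists f, 0 < lhs f.
  case: hX => a [b /eqP ab].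
  move: hV => /card_gt1P[x [y [_ _ xy]]].
  (* This map separates [x] from [y], and both have positive weight. *)
  exists (fun v => if v == x then a else b); rewrite /lhs mulr_gt0 //.
    rewrite divr_gt0 // /tweight (bigD1 x) //= ltr_pwDl //.
    by apply: sumr_ge0 => z _; rewrite ltW.
  rewrite pair_bigA (bigD1 (x, y)) //= ltr_pwDl //.
    by rewrite eqxx eq_sym (negbTE xy) !mulr_gt0 // mdist_gt0.
  apply: sumr_ge0 => z _; apply: mulr_ge0; last exact: sqr_ge0.
  by rewrite mulr_ge0 // ltW.
(* Zero energy would force [lhs f0 <= 0] through the inequality with constant [A]. *)
have energy_f0 : 0 < energy f0.
  rewrite lt_def energy0 andbT; apply/eqP => e0.
  by have := poincareA f0; rewrite e0 mulr0 leNgt lhs_f0.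
have A0 : 0 < A.
  by rewrite -(pmulr_lgt0 _ energy_f0) (lt_le_trans lhs_f0).
pose S := poincare_constant m X.
have SA : S A by split.
have Slb f : 0 < energy f -> lbound S (lhs f / energy f).
  by move=> ef C [_ /(_ f)]; rewrite ler_pdivrMr.
have ratio_inf f : 0 < energy f -> lhs f / energy f <= inf S.
  by move=> ef; apply: lb_le_inf; [exists A|exact: Slb].
have infS : forall C, S C -> inf S <= C.
  by move=> C SC; apply: ge_inf SC; exists (lhs f0 / energy f0); apply: Slb.
(* The infimum is attained: it dominates every ratio [lhs f / energy f], hence is positive by [f0].
   If [energy f] is zero, [poincareA] gives [lhs f <= 0], so any constant works. *)
have S_inf : S (inf S).
  split; first by apply: lt_le_trans (ratio_inf _ energy_f0); rewrite divr_gt0.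
  move=> f; have [ef|] := ltP 0 (energy f).
    by rewrite -ler_pdivrMr // ratio_inf.
  move=> ef; have {}ef : energy f = 0 by apply/eqP; rewrite eq_le ef energy0.
  by have := poincareA f; rewrite /lhs /energy in ef *; rewrite ef !mulr0.
rewrite /spectral_gap.
(* Since [inf S] is a least element, [xget] returns a genuine one and not the default 0. *)
have [[lam0 _] leastlam] : least_elements S (xget 0 (least_elements S)).
  by apply: xgetPex; exists (inf S).
by rewrite div1r lef_pV2 ?posrE // leastlam.
Qed.
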